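(* Let $G,G'$ be finite groups, let $\pi,\pi'$ be orthogonal representations of $G$ and $G'$ respectively, with $\deg\pi=d$ and $\deg\pi'=d'$, and let $\Pi=\pi\boxtimes\pi'$ be their external tensor product, an orthogonal representation of $G\times G'$. Then $\Pi$ is spinorial if and only if both of the following hold: (i) the restriction of $\Pi$ to each of $G\times 1$ and $1\times G'$ is spinorial, and (ii) $dd'+1$ is even, or $\det\pi=1$, or $\det\pi'=1$.
   Context: Representations are finite-dimensional complex representations. An orthogonal representation of a group $G$ is a homomorphism $\pi:G\to\mathrm{O}(V)$, where $V$ is a finite-dimensional complex vector space with nondegenerate quadratic form $Q$. Let $C(V)$ be the Clifford algebra, the quotient of $T(V)$ by the two-sided ideal generated by $\{v\otimes v-Q(v):v\in V\}$. $\mathrm{Pin}^-(V)$ is the subgroup of $C(V)^\times$ generated by the $u\in V$ with $Q(u)=-1$; it is a double cover of $\mathrm{O}(V)$, the covering map sending each such $u$ to the reflection in the hyperplane orthogonal to $u$, with kernel $\{\pm1\}$. The representation $\pi$ is called spinorial if it lifts to $\mathrm{Pin}^-(V)$, i.e. there is a homomorphism $G\to\mathrm{Pin}^-(V)$ whose composition with the covering map is $\pi$. Known criterion: $\pi$ is spinorial iff $w_2(\pi)+w_1(\pi)^2=0$ in $H^2(G,\mathbb{Z}/2\mathbb{Z})$, where $w_i(\pi)$ are the Stiefel-Whitney classes of $\pi$ (pullbacks of the universal classes on $B\mathrm{O}(V)$). *)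

(* Defs.v *)
From HB Require Import structures.
From mathcomp Require Import all_boot all_order all_fingroup all_algebra.
From mathcomp Require Import all_character.
From mathcomp Require Import generic_quotient ring_quotient.
From mathcomp Require Import boolp reals.
From mathcomp Require Import complex mxtens monalg.

Set Implicit Arguments.
Unset Strict Implicit.
Unset Printing Implicit Defensive.

Import GRing.Theory.
Local Open Scope ring_scope.
Local Open Scope quotient_scope.

Section TwoSidedQuotient.
Variables (K : fieldType) (A : algType K) (S : A -> Prop).

Inductive gen_ideal : A -> Prop :=
| gen_ideal0 : gen_ideal 0
| gen_idealD x y : gen_ideal x -> gen_ideal y -> gen_ideal (x + y)
| gen_idealM a s b : S s -> gen_ideal (a * s * b).

Lemma gen_ideal_mull a x : gen_ideal x -> gen_ideal (a * x).
Proof.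
elim=> [|y z _ ihy _ ihz|b s c Ss]; first by rewrite mulr0; constructor.
  by rewrite mulrDr; constructor.
by rewrite !mulrA; constructor.
Qed.

Lemma gen_ideal_mulr a x : gen_ideal x -> gen_ideal (x * a).
Proof.
elim=> [|y z _ ihy _ ihz|b s c Ss]; first by rewrite mul0r; constructor.
  by rewrite mulrDl; constructor.
by rewrite -[_ * a]mulrA; constructor.
Qed.

Lemma gen_ideal_gen s : S s -> gen_ideal s.
Proof. by move=> Ss; rewrite -[s]mul1r -[_ * s]mulr1; constructor. Qed.

Definition gen_ideal_pred : {pred A} := fun x => `[< gen_ideal x >].

Lemma gen_ideal_zmod_closed : zmod_closed gen_ideal_pred.
Proof.
split=> [|x y]; first by apply/asboolP; constructor.
move=> /asboolP Ix /asboolP Iy; apply/asboolP; apply: gen_idealD => //.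
by rewrite -mulN1r; apply: gen_ideal_mull.
Qed.
HB.instance Definition _ :=
  GRing.isZmodClosed.Build A gen_ideal_pred gen_ideal_zmod_closed.

(* ring_quotient.v only equips quotients of commutative rings with a product. *)
Definition quot_alg := Quotient.quot gen_ideal_pred.

HB.instance Definition _ := EqQuotient.on quot_alg.
HB.instance Definition _ := GRing.Zmodule.on quot_alg.

Definition quot_pi (x : A) : quot_alg := \pi x.

Lemma quot_pi_eq x y : quot_pi x = quot_pi y <-> gen_ideal (x - y).
Proof.
split=> [/eqP|Ixy]; last apply/eqP.
  by rewrite /quot_pi -Quotient.idealrBE => /asboolP.
by rewrite /quot_pi -Quotient.idealrBE; apply/asboolP.
Qed.

Lemma quot_piK (q : quot_alg) : quot_pi (repr q) = q.
Proof. exact: reprK. Qed.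

Lemma quot_pi_is_zmod_morphism : zmod_morphism quot_pi.
Proof. by move=> x y; rewrite /quot_pi !piE. Qed.
HB.instance Definition _ :=
  GRing.isZmodMorphism.Build A quot_alg quot_pi quot_pi_is_zmod_morphism.

Definition quot_one : quot_alg := quot_pi 1.
Definition quot_mul (p q : quot_alg) : quot_alg := quot_pi (repr p * repr q).
Definition quot_scale (c : K) (q : quot_alg) : quot_alg := quot_pi (c *: repr q).

Lemma quot_mulE x y : quot_mul (quot_pi x) (quot_pi y) = quot_pi (x * y).
Proof.
apply/quot_pi_eq.
have /quot_pi_eq Ix := quot_piK (quot_pi x).
have /quot_pi_eq Iy := quot_piK (quot_pi y).
move: Ix Iy; set x' := repr _; set y' := repr _ => Ix Iy.
have -> : x' * y' - x * y = (x' - x) * y' + x * (y' - y).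
  by rewrite mulrBl mulrBr addrA subrK.
by apply: gen_idealD; [apply: gen_ideal_mulr|apply: gen_ideal_mull].
Qed.

Lemma quot_scaleE c x : quot_scale c (quot_pi x) = quot_pi (c *: x).
Proof.
apply/quot_pi_eq; rewrite -scalerBr -mulr_algl; apply: gen_ideal_mull.
by apply/quot_pi_eq/quot_piK.
Qed.

Lemma quot_ind (P : quot_alg -> Prop) :
  (forall x, P (quot_pi x)) -> forall q, P q.
Proof. by move=> Ppi q; rewrite -[q]quot_piK. Qed.

Fact quot_mulA : associative quot_mul.
Proof.
by do 3!elim/quot_ind=> ?; rewrite !quot_mulE mulrA.
Qed.
Fact quot_mul1q : left_id quot_one quot_mul.
Proof. by elim/quot_ind=> x; rewrite quot_mulE mul1r. Qed.
Fact quot_mulq1 : right_id quot_one quot_mul.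
Proof. by elim/quot_ind=> x; rewrite quot_mulE mulr1. Qed.
Fact quot_mulDl : left_distributive quot_mul +%R.
Proof.
by do 3!elim/quot_ind=> ?; rewrite -raddfD !quot_mulE -raddfD mulrDl.
Qed.
Fact quot_mulDr : right_distributive quot_mul +%R.
Proof.
by do 3!elim/quot_ind=> ?; rewrite -raddfD !quot_mulE -raddfD mulrDr.
Qed.
HB.instance Definition _ := GRing.Zmodule_isPzRing.Build quot_alg
  quot_mulA quot_mul1q quot_mulq1 quot_mulDl quot_mulDr.

Fact quot_scaleA a b q : quot_scale a (quot_scale b q) = quot_scale (a * b) q.
Proof. by elim/quot_ind: q => x; rewrite !quot_scaleE scalerA. Qed.
Fact quot_scale1 : left_id 1 quot_scale.
Proof. by elim/quot_ind=> x; rewrite quot_scaleE scale1r. Qed.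
Fact quot_scaleDr : right_distributive quot_scale +%R.
Proof.
by move=> c; do 2!elim/quot_ind=> ?; rewrite -raddfD !quot_scaleE -raddfD scalerDr.
Qed.
Fact quot_scaleDl q : {morph quot_scale^~ q : a b / a + b}.
Proof.
by elim/quot_ind: q => x a b; rewrite !quot_scaleE -raddfD scalerDl.
Qed.
HB.instance Definition _ := GRing.Zmodule_isLmodule.Build K quot_alg
  quot_scaleA quot_scale1 quot_scaleDr quot_scaleDl.

(* The library's algebra structures require 1 != 0, which depends on S, so the *)
(* compatibility of scaling with the product is stated by the next two lemmas. *)
Lemma quot_scaleAl (c : K) (p q : quot_alg) : c *: (p * q) = (c *: p) * q.
Proof.
elim/quot_ind: p => x; elim/quot_ind: q => y; rewrite /GRing.scale /GRing.mul /=.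
by rewrite !(quot_mulE, quot_scaleE) scalerAl.
Qed.

Lemma quot_scaleAr (c : K) (p q : quot_alg) : c *: (p * q) = p * (c *: q).
Proof.
elim/quot_ind: p => x; elim/quot_ind: q => y; rewrite /GRing.scale /GRing.mul /=.
by rewrite !(quot_mulE, quot_scaleE) scalerAr.
Qed.

Lemma quot_pi_is_monoid_morphism : monoid_morphism quot_pi.
Proof. by split=> // x y; rewrite -quot_mulE. Qed.
HB.instance Definition _ := GRing.isMonoidMorphism.Build A quot_alg quot_pi
  quot_pi_is_monoid_morphism.

Lemma quot_pi_is_scalable : scalable quot_pi.
Proof. by move=> c x; rewrite -quot_scaleE. Qed.
HB.instance Definition _ := GRing.isScalable.Build K A quot_alg *:%R quot_pi
  quot_pi_is_scalable.

End TwoSidedQuotient.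

Section TensorAlgebra.
Variables (K : fieldType) (n : nat).

(* T(K^n) is realized as the free associative algebra on the standard basis:  *)
(* the basis word i_1 ... i_k stands for e_{i_1} (x) ... (x) e_{i_k}.         *)
Definition tensor_alg := {malg K[{fmonom 'I_n}]}.

HB.instance Definition _ := GRing.Lalgebra.on tensor_alg.
HB.instance Definition _ := GRing.NzRing.on tensor_alg.

Fact tensor_alg_scaleAr (c : K) (x y : tensor_alg) : c *: (x * y) = x * (c *: y).
Proof.
rewrite -!mul_malgC mulrA; suff -> : c%:MP * x = x * c%:MP by rewrite mulrA.
rewrite !malgM_def fgmulUg fgmulgU; apply: eq_bigr => k _.
by rewrite mulrC mulm1 mul1m.
Qed.
HB.instance Definition _ :=
  GRing.Lalgebra_isAlgebra.Build K tensor_alg tensor_alg_scaleAr.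

Definition tensor_inj (v : 'cV[K]_n) : tensor_alg :=
  \sum_i v i 0 *: << fmu i >>.

Lemma tensor_inj_is_linear : linear tensor_inj.
Proof.
move=> c u v; rewrite /tensor_inj scaler_sumr -big_split; apply: eq_bigr => i _.
by rewrite !mxE scalerDl scalerA.
Qed.
HB.instance Definition _ := GRing.isLinear.Build K 'cV[K]_n tensor_alg *:%R
  tensor_inj tensor_inj_is_linear.

End TensorAlgebra.

Section QuadraticSpace.
Variables (K : fieldType) (n : nat).
Implicit Types (B M : 'M[K]_n) (u v : 'cV[K]_n).

Definition qform B v : K := (v^T *m B *m v) 0 0.

(* Away from characteristic 2, symmetric Gram matrices correspond to          *)
(* quadratic forms on K^n, and invertible ones to nondegenerate forms.        *)
Definition nondeg_gram B : Prop := B^T = B /\ B \in unitmx.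

Definition in_orthogonal B M : Prop :=
  M \in unitmx /\ forall v, qform B (M *m v) = qform B v.

(* v |-> v - (2 b(u, v) / Q(u)) u, where b is the bilinear form of B *)
Definition reflection B u : 'M[K]_n :=
  1%:M - (2%:R / qform B u) *: (u *m (u^T *m B)).

Definition clifford B :=
  quot_alg (fun x : tensor_alg K n =>
    exists v, x = tensor_inj v * tensor_inj v - (qform B v)%:A).

Definition cliff_inj B (v : 'cV[K]_n) : clifford B := quot_pi _ (tensor_inj v).

Lemma cliff_inj_sqr B v :
  cliff_inj B v * cliff_inj B v = qform B v *: (1 : clifford B).
Proof.
have -> : qform B v *: (1 : clifford B) = quot_pi _ ((qform B v)%:A).
  by rewrite linearZ rmorph1.
by rewrite /cliff_inj -rmorphM; apply/quot_pi_eq/gen_ideal_gen; exists v.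
Qed.

Inductive pin_minus B : clifford B -> Prop :=
| pin_minus1 : pin_minus 1
| pin_minus_gen u : qform B u = -1 -> pin_minus (cliff_inj B u)
| pin_minusM x y : pin_minus x -> pin_minus y -> pin_minus (x * y)
| pin_minusV x y : x * y = 1 -> y * x = 1 -> pin_minus x -> pin_minus y.

(* The graph of the covering homomorphism Pin^-(V) -> O(V): the subgroup of   *)
(* C(V)^* x O(V) generated by the pairs (u, reflection along u).              *)
Inductive pin_cover B : clifford B -> 'M[K]_n -> Prop :=
| pin_cover1 : pin_cover 1 1%:M
| pin_cover_gen u :
    qform B u = -1 -> pin_cover (cliff_inj B u) (reflection B u)
| pin_coverM x y M N :
    pin_cover x M -> pin_cover y N -> pin_cover (x * y) (M *m N)
| pin_coverV x y M :
    x * y = 1 -> y * x = 1 -> pin_cover x M -> pin_cover y (invmx M).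

End QuadraticSpace.

Section Spinorial.
Variables (K : fieldType) (gT : finGroupType) (G : {group gT}) (n : nat).
Variables (B : 'M[K]_n) (rG : mx_representation K G n).

(* Group elements act on column vectors: g maps v to rG g *m v. *)
Definition orthogonal_repr : Prop :=
  forall g, g \in G -> in_orthogonal B (rG g).

Definition spinorial : Prop :=
  exists phi : gT -> clifford B,
    [/\ forall g, g \in G -> pin_minus (phi g),
        {in G &, forall g h, phi (g * h)%g = phi g * phi h}
      & forall g, g \in G -> pin_cover (phi g) (rG g)].

Definition trivial_det : Prop := forall g, g \in G -> \det (rG g) = 1.

End Spinorial.

Section ExternalTensor.
Variables (K : fieldType) (gT gT' : finGroupType).
Variables (G : {group gT}) (G' : {group gT'}) (d d' : nat).
Variables (rG : mx_representation K G d) (rG' : mx_representation K G' d').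

Definition ext_tensor_mx (x : gT * gT') : 'M[K]_(d * d') := rG x.1 *t rG' x.2.

Lemma ext_tensor_mx_repr : mx_repr (setX G G') ext_tensor_mx.
Proof.
split=> [|x y].
  apply/matrixP=> i j; rewrite /ext_tensor_mx !repr_mx1.
  case: (mxtens_indexP i) (mxtens_indexP j) => i1 i2 [j1 j2].
  rewrite tensmxE !mxE -natrM mulnb.
  by rewrite (can_eq (@mxtens_indexK _ _)) xpair_eqE.
case: x y => [x1 x2] [y1 y2] /setXP[/= Gx1 G'x2] /setXP[/= Gy1 G'y2].
by rewrite /ext_tensor_mx !repr_mxM // tensmx_mul.
Qed.
Definition ext_tensor_repr := MxRepresentation ext_tensor_mx_repr.

Lemma setX1_sub : setX G 1%g \subset setX G G'.
Proof. by rewrite setXS ?sub1G. Qed.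

Lemma set1X_sub : setX 1%g G' \subset setX G G'.
Proof. by rewrite setXS ?sub1G. Qed.

End ExternalTensor.

(* Main.v *)
(* A lift of [A (x) 1] to Pin and a lift of [1 (x) C] commute up to the sign  *)
(* [(det A ^ (dd' + 1)) ^ m], where [det C = (-1) ^ m]; condition (ii) says   *)
(* that all these signs are 1, as [1 <> -1] in the Clifford algebra.          *)
(* By Cartan-Dieudonne [C] is a product of [m] reflections [r_w], and         *)
(* [1 (x) r_w] lifts to the product of the [e_i (x) w], with [e_i] an         *)
(* orthonormal basis of V.  A lift [x] of [A (x) 1] acts on vectors by        *)
(* [x v x^-1 = det(A)^d' (A (x) 1) v], so it turns [prod_i (e_i (x) w)] into  *)
(* [det(A)^(dd') prod_i (A e_i (x) w)].  Finally [prod_i (A e_i (x) w)] is    *)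
(* [det(A) prod_i (e_i (x) w)], as for any volume element.                    *)

Require Import Defs.
From HB Require Import structures.
From mathcomp Require Import all_boot all_order all_fingroup all_algebra.
From mathcomp Require Import all_character.
From mathcomp Require Import reals complex mxtens monalg.
From mathcomp Require Import ring.

Set Implicit Arguments.
Unset Strict Implicit.
Unset Printing Implicit Defensive.

Import GRing.Theory Num.Theory.
Local Open Scope ring_scope.

(** Since G x 1 and 1 x G' commute and generate G x G', a lift of the external tensor product
    amounts to lifts of its two restrictions whose values commute. Everything thus rests on the sign
    by which a lift of A (x) 1 and a lift of 1 (x) C commute. This sign does not depend on the lifts
    chosen ([pin_cover_same_comm]), so it may be computed on an explicit lift of 1 (x) C.
    [tens_commute] finds it to be -1 exactly when det A = det C = -1 and dd'+1 is odd. It combines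
    the decomposition of isometries into reflections ([orthogonal_reflection_prod]), the action of
    Pin on vectors by conjugation ([pin_cover_twists]), and the fact that a volume element scales by
    the determinant ([cliff_prod_reflection_prod], from [cmap_reflection_prod]). If (ii) holds, all
    signs are 1 and the product of the two lifts is a homomorphism. If (ii) fails, some pair of
    lifts anticommutes although the group elements commute; this is absurd because 1 is nonzero in
    the Clifford algebra ([clifford_tens_neq0]). *)

Lemma det_add1_mulmx (R : comNzRingType) m n (X : 'M[R]_(m, n)) (Y : 'M_(n, m)) :
  \det (1%:M + X *m Y) = \det (1%:M + Y *m X).
Proof.
(* Sylvester's identity: [e1] and [e2] factor one block matrix through each of its two Schur
   complements. *)
have e1 : block_mx 1%:M (- X) Y 1%:M =
    block_mx 1%:M 0 Y 1%:M *m block_mx 1%:M (- X) 0 (1%:M + Y *m X).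
  by rewrite mulmx_block !(mulmx1, mul1mx, mulmx0, mul0mx, addr0) mulmxN addrCA addNr addr0.
have e2 : block_mx 1%:M (- X) Y 1%:M =
    block_mx 1%:M (- X) 0 1%:M *m block_mx (1%:M + X *m Y) 0 Y 1%:M.
  by rewrite mulmx_block !(mulmx1, mul1mx, mulmx0, mul0mx, addr0, add0r) mulNmx addrK.
have := congr1 determinant e1; rewrite {1}e2 !det_mulmx !(det_lblock, det_ublock).
by rewrite !(det1, mul1r, mulr1).
Qed.

(** * Bilinear forms, reflections and isometries *)

Definition bform (K : fieldType) n (B : 'M[K]_n) (u v : 'cV[K]_n) : K :=
  (u^T *m B *m v) 0 0.

Section BilinearForm.
Variables (K : fieldType) (n : nat) (B : 'M[K]_n).
Hypothesis symB : B^T = B.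
Implicit Types (u v w : 'cV[K]_n) (M : 'M[K]_n).

Lemma bformE u v : u^T *m B *m v = (bform B u v)%:M.
Proof. exact: mx11_scalar. Qed.

Lemma bform_col (E : 'M[K]_n) i j :
  bform B (col i E) (col j E) = (E^T *m B *m E) i j.
Proof.
by rewrite /bform tr_col -row_mul !mxE; apply: eq_bigr => k _; rewrite !mxE.
Qed.

Lemma bformDr u v w : bform B u (v + w) = bform B u v + bform B u w.
Proof. by rewrite /bform mulmxDr mxE. Qed.

Lemma bformZr u c v : bform B u (c *: v) = c * bform B u v.
Proof. by rewrite /bform -scalemxAr mxE. Qed.

Lemma bformC u v : bform B u v = bform B v u.
Proof.
have -> : bform B u v = (u^T *m B *m v)^T 0 0 by rewrite mxE.
by rewrite !trmx_mul trmxK symB mulmxA.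
Qed.

Lemma bformDl u v w : bform B (u + v) w = bform B u w + bform B v w.
Proof. by rewrite bformC bformDr !(bformC w). Qed.

Lemma bformZl u c v : bform B (c *: u) v = c * bform B u v.
Proof. by rewrite bformC bformZr bformC. Qed.

Lemma qformD u v : qform B (u + v) = qform B u + qform B v + 2%:R * bform B u v.
Proof.
rewrite -![qform B _]/(bform B _ _) bformDr !bformDl (bformC v u).
ring.
Qed.

Lemma qformZ c u : qform B (c *: u) = c ^+ 2 * qform B u.
Proof. by rewrite -![qform B _]/(bform B _ _) bformZr bformZl mulrA expr2. Qed.

Lemma qformB u v : qform B (u - v) = qform B u + qform B v - 2%:R * bform B u v.
Proof. by rewrite -scaleN1r qformD qformZ bformZr; ring. Qed.

Lemma qformN u : qform B (- u) = qform B u.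
Proof. by rewrite -scaleN1r qformZ; ring. Qed.

Lemma reflectionE u v :
  reflection B u *m v = v - (2%:R / qform B u * bform B u v) *: u.
Proof.
rewrite /reflection mulmxBl mul1mx -scalemxAl -mulmxA bformE mul_mx_scalar.
by rewrite scalerA.
Qed.

Lemma reflectionZ c u : c != 0 -> reflection B (c *: u) = reflection B u.
Proof.
move=> c0; rewrite /reflection qformZ [(c *: u)^T]linearZ /= -!scalemxAl -scalemxAr !scalerA.
congr (_ - _ *: _); case: (eqVneq (qform B u) 0) => [->|q0].
  by rewrite mulr0 !invr0 !mulr0 !mul0r.
by field; rewrite c0 q0.
Qed.

Lemma det_reflection u : qform B u != 0 -> \det (reflection B u) = - 1.
Proof.
move=> q0; rewrite /reflection scalemxAl -mulNmx det_add1_mulmx mulmxN -scalemxAr bformE.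
rewrite -[bform B u u]/(qform B u) scale_scalar_mx divfK // det_mx11 !mxE /=.
by rewrite mulr2n opprD addrA subrr add0r.
Qed.

Lemma reflection_sqr u : qform B u != 0 -> reflection B u *m reflection B u = 1%:M.
Proof.
move=> q0; rewrite {2}/reflection mulmxBr mulmx1 -scalemxAr [_ *m (u *m _)]mulmxA.
have -> : reflection B u *m u = - u.
  rewrite reflectionE -[bform B u u]/(qform B u) divfK //.
  by rewrite scaler_nat mulr2n opprD addrA subrr sub0r.
by rewrite mulNmx scalerN opprK /reflection subrK.
Qed.

Lemma reflection_gram u : qform B u != 0 -> (reflection B u)^T *m B *m reflection B u = B.
Proof.
move=> q0; have -> : (reflection B u)^T *m B = B *m reflection B u.
  rewrite /reflection raddfB /= [(_ *: (_ *m _))^T]linearZ /= trmx1 !trmx_mul trmxK symB.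
  by rewrite mulmxBl mulmxBr mul1mx mulmx1 -scalemxAl -scalemxAr !mulmxA.
by rewrite -mulmxA reflection_sqr // mulmx1.
Qed.

Lemma bform_gram M u v : M^T *m B *m M = B -> bform B (M *m u) (M *m v) = bform B u v.
Proof. by move=> MO; rewrite -{2}MO /bform trmx_mul !mulmxA. Qed.

(** Polarization: [in_orthogonal] speaks only of the quadratic form, while later arguments use the
    Gram equation. *)
Lemma orthogonal_gram M : (2%:R : K) != 0 -> in_orthogonal B M -> M^T *m B *m M = B.
Proof.
move=> nz2 [_ MO].
have bMO u v : bform B (M *m u) (M *m v) = bform B u v.
  have := MO (u + v); rewrite mulmxDr !qformD !MO => /addrI.
  by move/(mulfI nz2).
have bd (X : 'M[K]_n) i j : bform X (delta_mx i 0) (delta_mx j 0) = X i j.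
  by rewrite /bform trmx_delta -rowE -colE !mxE.
by apply/matrixP=> i j; rewrite -bd /bform -[B i j]bd -bMO /bform trmx_mul !mulmxA.
Qed.

(** Equal norms give 2 b(a - b, a) = Q(a - b), so the reflection subtracts exactly a - b from a. *)
Lemma reflection_swap a b : qform B a = qform B b -> qform B (a - b) != 0 ->
  reflection B (a - b) *m a = b.
Proof.
move=> eqab q0; rewrite reflectionE.
suff -> : 2%:R / qform B (a - b) * bform B (a - b) a = 1.
  by rewrite scale1r opprB addrC subrK.
suff e : 2%:R * bform B (a - b) a = qform B (a - b) by rewrite mulrAC e mulfV.
rewrite qformB -scaleN1r bformDl bformZl (bformC b a).
rewrite -[bform B a a]/(qform B a) -eqab; set q := qform B a; set c := bform B a b.
ring.
Qed.

Lemma reflection_id u v : bform B u v = 0 -> reflection B u *m v = v.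
Proof. by move=> uv0; rewrite reflectionE uv0 mulr0 scale0r subr0. Qed.

Definition reflection_prod us : 'M[K]_n := \big[mulmx/1%:M]_(u <- us) reflection B u.

Lemma reflection_prod_cons u us :
  reflection_prod (u :: us) = reflection B u *m reflection_prod us.
Proof. by rewrite /reflection_prod big_cons. Qed.

Lemma reflection_prod_gram us : {in us, forall u, qform B u != 0} ->
  (reflection_prod us)^T *m B *m reflection_prod us = B.
Proof.
elim: us => [_|u us ih q0]; first by rewrite /reflection_prod big_nil trmx1 mul1mx mulmx1.
rewrite reflection_prod_cons trmx_mul -!mulmxA.
rewrite [(reflection B u)^T *m _]mulmxA [_ *m (reflection B u *m _)]mulmxA.
rewrite reflection_gram ?q0 ?mem_head // mulmxA ih // => v vus.
by apply: q0; rewrite inE vus orbT.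
Qed.

Lemma det_reflection_prod us : {in us, forall u, qform B u != 0} ->
  \det (reflection_prod us) = (- 1) ^+ size us.
Proof.
elim: us => [_|u us ih q0]; first by rewrite /reflection_prod big_nil det1.
rewrite reflection_prod_cons det_mulmx det_reflection ?q0 ?mem_head // ih ?exprS //.
by move=> v vus; apply: q0; rewrite inE vus orbT.
Qed.

End BilinearForm.

(** * Orthonormal bases and the Cartan-Dieudonne theorem *)

Definition orthonormal_basis (K : fieldType) n (B E : 'M[K]_n) := E^T *m B *m E = 1%:M.

Section OrthonormalBasis.
Variables (K : numClosedFieldType) (n : nat) (B : 'M[K]_n).
Hypotheses (symB : B^T = B).
Implicit Types (u v w : 'cV[K]_n) (M E : 'M[K]_n).

(** The complement of the columns of [E] contains some w <> 0. If w is isotropic, nondegeneracy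
    yields v' in the complement with b(w, v') <> 0; then v' is anisotropic, or else Q(w + v') = 2
    b(w, v') <> 0. *)
Lemma isotropic_orthogonal_complement k (E : 'M[K]_(n, k)) : B \in unitmx ->
    (k < n)%N -> E^T *m B *m E = 1%:M ->
  exists2 w : 'cV_n, E^T *m B *m w = 0 & qform B w != 0.
Proof.
move=> uB ltkn EO.
have [w [w0 wO]] : exists w : 'cV_n, w != 0 /\ E^T *m B *m w = 0.
  have : kermx (B *m E) != 0.
    rewrite kermx_eq0 /row_free; apply: contraL ltkn => /eqP <-.
    by rewrite -leqNgt rank_leq_col.
  move/rowV0Pn=> [v /sub_kermxP vk v0]; exists v^T; split.
    by apply: contra v0 => /eqP e; rewrite -[v]trmxK e trmx0.
  by rewrite -{1}symB -trmx_mul -trmx_mul vk trmx0.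
case: (eqVneq (qform B w) 0) => [qw0|]; last by exists w.
have [v bwv] : exists v, bform B w v != 0.
  have : w^T *m B != 0.
    apply: contra w0 => /eqP e; rewrite -[w]trmxK -[w^T](mulmxK uB) e.
    by rewrite mul0mx trmx0.
  move/matrix0Pn=> [i [j]]; rewrite (ord1 i) => nz; exists (delta_mx j 0).
  by rewrite /bform -colE mxE.
(* Projecting v off the columns of [E] leaves its pairing with w unchanged. *)
pose v' := v - E *m (E^T *m B *m v).
have v'O : E^T *m B *m v' = 0 by rewrite mulmxBr [_ *m (E *m _)]mulmxA EO mul1mx subrr.
have bwv' : bform B w v' = bform B w v.
  have wE : w^T *m B *m E = 0.
    by apply: trmx_inj; rewrite !trmx_mul trmxK symB mulmxA wO trmx0.
  by rewrite /v' /bform mulmxBr [_ *m (E *m _)]mulmxA wE mul0mx subr0.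
case: (eqVneq (qform B v') 0) => [qv0|]; last by exists v'.
exists (w + v'); first by rewrite mulmxDr wO v'O addr0.
by rewrite qformD // qw0 qv0 !add0r bwv' mulf_neq0 // pnatr_eq0.
Qed.

Lemma exists_orthonormal_basis : B \in unitmx -> exists E, orthonormal_basis B E.
Proof.
move=> uB; suff H k : (k <= n)%N -> exists E : 'M[K]_(n, k), E^T *m B *m E = 1%:M.
  by have [E EO] := H n (leqnn n); exists E.
elim: k => [_|k ih ltkn]; first by exists 0; apply/matrixP=> -[].
have [E EO] := ih (ltnW ltkn).
have [w wO qw] := isotropic_orthogonal_complement uB ltkn EO.
pose w1 := (sqrtC (qform B w))^-1 *: w.
have q1 : qform B w1 = 1 by rewrite qformZ // exprVn sqrtCK mulVf.
have wO1 : E^T *m B *m w1 = 0 by rewrite -scalemxAr wO scaler0.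
have wO2 : w1^T *m B *m E = 0.
  by apply: trmx_inj; rewrite !trmx_mul trmxK symB mulmxA wO1 trmx0.
suff : (row_mx w1 E)^T *m B *m row_mx w1 E = 1%:M.
  by exists (row_mx w1 E : 'M_(n, 1 + k)).
rewrite tr_row_mx mul_col_mx mul_col_row EO wO1 wO2 bformE -[bform B w1 w1]/(qform B w1) q1.
by rewrite -scalar_mx_block.
Qed.

(* Cartan-Dieudonne: [M] is corrected by reflections so as to fix one more    *)
(* basis vector [e] at a time.  If [M e - e] is isotropic then [M e + e] is   *)
(* not, and reflecting along it and then along [e] does the job.              *)
Lemma orthogonal_reflection_prod (c : K) M E :
    c != 0 -> orthonormal_basis B E -> M^T *m B *m M = B ->
  exists2 us, {in us, forall u, qform B u = c} & M = reflection_prod B us.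
Proof.
move=> c0 EO.
have uE : E \in unitmx.
  by have [] := mulmx1_unit EO.
pose e i := col i E.
have bee i j : bform B (e i) (e j) = (i == j)%:R.
  by rewrite bform_col EO mxE.
(* Rescaling an anisotropic vector to norm [c] does not change its reflection. *)
have step u (N : 'M_n) : qform B u != 0 -> exists2 u', qform B u' = c &
    N = reflection B u' *m (reflection B u *m N).
  move=> q0; exists (sqrtC (c / qform B u) *: u).
    by rewrite qformZ // sqrtCK divfK.
  rewrite reflectionZ ?sqrtC_eq0 ?mulf_neq0 ?invr_eq0 //.
  by rewrite mulmxA reflection_sqr // mul1mx.
(* Here [k] bounds the number of basis vectors still to be fixed: the first [n - k] already are. *)
suff H k : (k <= n)%N -> forall M, M^T *m B *m M = B ->
    (forall i : 'I_n, (i < n - k)%N -> M *m e i = e i) ->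
    exists2 us, {in us, forall u, qform B u = c} & M = reflection_prod B us.
  by move=> MO; apply: (H n _ M) => // i; rewrite subnn.
elim: k => [_ {}M _ Mfix|k ih ltkn {}M MO Mfix].
  exists [::] => //; rewrite /reflection_prod big_nil.
  apply: (can_inj (mulmxK uE)); rewrite mul1mx; apply/matrixP=> i j.
  have := Mfix j; rewrite subn0 => /(_ (ltn_ord j)) /colP/(_ i).
  by rewrite /e !colE mulmxA -!colE [LHS]mxE [RHS]mxE.
have ltn : (n - k.+1 < n)%N by rewrite ltn_subrL /= (leq_ltn_trans _ ltkn).
pose i0 := Ordinal ltn; set a := M *m e i0.
have fixr u N : qform B u != 0 -> N^T *m B *m N = B ->
    (reflection B u *m N)^T *m B *m (reflection B u *m N) = B.
  move=> q0 NO; rewrite trmx_mul -!mulmxA [B *m _]mulmxA [_ *m (_ *m N)]mulmxA.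
  by rewrite [_ *m (B *m _)]mulmxA reflection_gram // mulmxA.
(* The vectors already fixed are orthogonal to both [a] and [e i0], so the new reflections leave
   them fixed. *)
have orth (i : 'I_n) : (i < n - k.+1)%N -> bform B a (e i) = 0 /\ bform B (e i0) (e i) = 0.
  move=> lti; have ne : (i0 == i) = false by apply/negbTE; rewrite -val_eqE /= gtn_eqF.
  by rewrite -{1}(Mfix i lti) /a bform_gram // bee ne.
have qa : qform B a = qform B (e i0).
  by rewrite -[qform B a]/(bform B a a) bform_gram.
have qe : qform B (e i0) = 1 by rewrite -[LHS]/(bform B _ _) bee eqxx.
have lei (i : 'I_n) : (i < n - k)%N -> i = i0 \/ (i < n - k.+1)%N.
  rewrite -(subnSK ltkn) ltnS leq_eqVlt => /orP[/eqP eqi|]; last by right.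
  by left; apply: val_inj.
case: (eqVneq (qform B (a - e i0)) 0) => [q0|nq].
  have nq : qform B (a + e i0) != 0.
    have : qform B (a - e i0) + qform B (a + e i0) = 4%:R.
      by rewrite qformB // qformD // qa qe; ring.
    by rewrite q0 add0r => ->; rewrite pnatr_eq0.
  have nqe : qform B (e i0) != 0 by rewrite qe oner_eq0.
  have [u1 q1 eM1] := step _ M nq.
  have [u2 q2 eM2] := step _ (reflection B (a + e i0) *m M) nqe.
  have [||us qus e3] := ih (ltnW ltkn) (reflection B (e i0) *m (reflection B (a + e i0) *m M)).
  - exact: (fixr _ _ nqe (fixr _ _ nq MO)).
  - move=> i /lei[->|lti].
      have ra : reflection B (a + e i0) *m a = - e i0.
        rewrite -[e i0 in X in X *m _]opprK reflection_swap ?opprK //.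
        by rewrite qformN.
      rewrite -!mulmxA -/a ra mulmxN reflectionE -[bform B _ _]/(qform B _) qe.
      by rewrite divr1 mulr1 scaler_nat mulr2n opprB addrK.
    have [o1 o2] := orth i lti.
    rewrite -!mulmxA Mfix // !reflection_id // bformDl // o1 o2 addr0 //.
  exists [:: u1, u2 & us].
    by move=> u; rewrite !inE => /or3P[/eqP->|/eqP->|/qus].
  by rewrite !reflection_prod_cons -e3 -eM2 -eM1.
have [u1 q1 eM1] := step _ M nq.
have [||us qus e3] := ih (ltnW ltkn) (reflection B (a - e i0) *m M).
- exact: fixr.
- move=> i /lei[->|lti]; first by rewrite -mulmxA reflection_swap.
  have [o1 o2] := orth i lti.
  rewrite -mulmxA Mfix // reflection_id // -scaleN1r bformDl // bformZl //.
  by rewrite o1 o2 mulr0 addr0.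
exists (u1 :: us); first by move=> u; rewrite inE => /orP[/eqP->|/qus].
by rewrite reflection_prod_cons -e3 -eM1.
Qed.

End OrthonormalBasis.

(** * Computations with the Clifford relations *)

(* [s] plays the role of the scalars [c *: 1]: the Clifford algebra, possibly *)
(* trivial a priori, is only a ring and a module for the library.             *)
Section CliffordMap.
Variables (K : fieldType) (n : nat) (B : 'M[K]_n) (A : pzRingType).
Variables (s : {rmorphism K -> A}) (j : {additive 'cV[K]_n -> A}).
Hypothesis symB : B^T = B.
Hypothesis sC : forall c x, x * s c = s c * x.
Hypothesis jZ : forall c v, j (c *: v) = s c * j v.
Hypothesis j_sqr : forall v, j v * j v = s (qform B v).
Implicit Types (u v w : 'cV[K]_n) (M : 'M[K]_n) (x y z : A).

Lemma cmap_anticomm u v : j u * j v + j v * j u = s (2%:R * bform B u v).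
Proof.
have := j_sqr (u + v); rewrite qformD // raddfD !rmorphD mulrDl !mulrDr !j_sqr /=.
move=> e; apply: (addrI (s (qform B u) + s (qform B v))); rewrite -e.
by rewrite addrACA [RHS]addrCA [LHS]addrC -!addrA addrCA; congr (_ + _); rewrite addrC -addrA.
Qed.

Lemma cmap_reflection u v : qform B u = - 1 ->
  j u * j v = s (- 1) * (j (reflection B u *m v) * j u).
Proof.
move=> qu; rewrite reflectionE qu invrN invr1 mulrN1 mulNr scaleNr opprK.
rewrite raddfD jZ mulrDl -mulrA j_sqr qu /= !rmorphN rmorph1 mulrN1 mulN1r.
by apply/eqP; rewrite -addr_eq0 addrA cmap_anticomm subrr.
Qed.

Lemma cmap_unit u : qform B u = - 1 -> j u * - j u = 1 /\ - j u * j u = 1.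
Proof. by move=> qu; rewrite mulrN mulNr j_sqr qu rmorphN rmorph1 opprK. Qed.

(** The relation x v x^-1 = c M v, written without an inverse of [x]. *)
Definition twists x M c := forall v, x * j v = s c * (j (M *m v) * x).

Lemma twists1 : twists 1 1%:M 1.
Proof. by move=> v; rewrite rmorph1 mul1mx !mul1r mulr1. Qed.

Lemma twistsM x y M N c d :
  twists x M c -> twists y N d -> twists (x * y) (M *m N) (c * d).
Proof.
move=> xM yN v; rewrite -mulrA yN mulrA sC -mulrA [x * (_ * y)]mulrA xM.
by rewrite mulmxA rmorphM [s c * s d]sC !mulrA.
Qed.

Lemma twistsV x y M c : x * y = 1 -> y * x = 1 -> M \in unitmx -> c != 0 ->
  twists x M c -> twists y (invmx M) c^-1.
Proof.
move=> xy yx uM c0 xM v.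
have := congr1 (fun t => s c^-1 * (y * t * y)) (xM (invmx M *m v)).
rewrite /= mulKVmx // (mulrA y x) yx mul1r => ->.
rewrite (mulrA y) sC -!mulrA xy mulr1 mulrA -rmorphM mulVf //.
by rewrite rmorph1 mul1r.
Qed.

Lemma twists_prod m x M c (f : 'I_m -> 'cV[K]_n) : twists x M c ->
  x * \prod_i j (f i) = s (c ^+ m) * (\prod_i j (M *m f i) * x).
Proof.
elim: m f => [|m ih] f xM; first by rewrite !big_ord0 rmorph1 !mul1r mulr1.
rewrite !big_ord_recl mulrA xM -!mulrA ih // exprS rmorphM -!mulrA; congr (_ * _).
by rewrite mulrA sC -mulrA.
Qed.

Lemma inverseM x x' y y' : x * x' = 1 /\ x' * x = 1 -> y * y' = 1 /\ y' * y = 1 ->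
  x * y * (y' * x') = 1 /\ y' * x' * (x * y) = 1.
Proof.
move=> [xx' x'x] [yy' y'y]; split.
  by rewrite mulrA -(mulrA x) yy' mulr1.
by rewrite mulrA -(mulrA y') x'x mulr1.
Qed.

Lemma comm_factorM x y y' c c' :
    x * y = s c * (y * x) -> x * y' = s c' * (y' * x) ->
  x * (y * y') = s (c * c') * (y * y' * x).
Proof.
move=> xy xy'; rewrite mulrA xy -!mulrA xy' (mulrA y) sC -!mulrA.
by rewrite rmorphM !mulrA.
Qed.

Lemma comm_factorZ x p q a b : x * p = s a * (q * x) -> q = s b * p ->
  x * p = s (a * b) * (p * x).
Proof. by move=> xp qp; rewrite xp qp rmorphM -!mulrA. Qed.

(** Cancelling [z] gives 1 = -1, hence 2 = 0 in [A], although 2 is the image of a unit of [K]. *)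
Lemma opp_unit_eq0 z z' : (2%:R : K) != 0 -> z * z' = 1 -> z = s (- 1) * z ->
  (1 : A) = 0.
Proof.
move=> nz2 zz' zN; have e : (1 : A) = s (- 1) by rewrite -[LHS]zz' zN -mulrA zz' mulr1.
rewrite -(rmorph1 s) -(mulVf nz2) rmorphM mulr2n rmorphD rmorph1 {2}e.
by rewrite rmorphN rmorph1 subrr mulr0.
Qed.

Lemma comm_mulACA x y z t : GRing.comm y z -> x * y * (z * t) = x * z * (y * t).
Proof. by move=> yz; rewrite mulrA -(mulrA x) yz !mulrA. Qed.

Lemma comm_factor x y y0 y1 c : y1 * y0 = 1 -> GRing.comm (y * y1) x ->
  x * y0 = s c * (y0 * x) -> x * y = s c * (y * x).
Proof.
move=> y10 zC e; have -> : y = (y * y1) * y0 by rewrite -mulrA y10 mulr1.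
by rewrite mulrA -zC -mulrA e mulrA sC -!mulrA.
Qed.

Lemma comm_inverse x y z : x * y = 1 -> y * x = 1 -> GRing.comm z x -> GRing.comm z y.
Proof.
move=> xy yx zx; rewrite /GRing.comm -[z * y]mul1r -yx -mulrA (mulrA x) -zx.
by rewrite -!mulrA xy mulr1.
Qed.

(* [j (f k)] anticommutes with every factor other than itself. *)
Lemma cmap_orthogonal_prod m (f : 'I_m -> 'cV[K]_n) k :
    (forall i l, i != l -> bform B (f i) (f l) = 0) ->
  j (f k) * \prod_i j (f i) = s ((- 1) ^+ m.-1) * (\prod_i j (f i) * j (f k)).
Proof.
move=> fO; pose c i : K := if i == k then 1 else - 1.
have -> : (- 1) ^+ m.-1 = \prod_i c i.
  rewrite (bigD1 k) //= {1}/c eqxx mul1r (eq_bigr (fun=> - 1)).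
    by rewrite prodr_const cardC1 card_ord.
  by move=> i /negbTE; rewrite /c => ->.
have step i : j (f k) * j (f i) = s (c i) * (j (f i) * j (f k)).
  rewrite /c; case: eqP => [->|/eqP ik]; first by rewrite rmorph1 mul1r.
  apply/eqP; rewrite rmorphN rmorph1 mulN1r -addr_eq0 cmap_anticomm.
  by rewrite fO 1?eq_sym // mulr0 raddf0.
rewrite -[in LHS]/(\prod_(i <- _) _) .
elim: (index_enum _) => [|i r ih]; first by rewrite !big_nil rmorph1 !mul1r mulr1.
rewrite !big_cons mulrA step -!mulrA ih rmorphM -!mulrA; congr (_ * _).
by rewrite mulrA sC -mulrA.
Qed.

(** A reflection inside the span of orthogonal vectors negates their volume element. Moving u past
    the product costs (-1)^(m-1) by orthogonality, term by term in u, and (-1)^m if each factor is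
    reflected on the way; compare the two and cancel u. *)
Lemma cmap_reflection_prod m (f : 'I_m -> 'cV[K]_n) (a : 'I_m -> K) u :
    (forall i l, i != l -> bform B (f i) (f l) = 0) ->
    u = \sum_i a i *: f i -> qform B u = - 1 ->
  \prod_i j (reflection B u *m f i) = - \prod_i j (f i).
Proof.
move=> fO defu qu; have [ju1 ju2] := cmap_unit qu.
(* The empty family is excluded: u would be 0, against Q(u) = -1. *)
case: m => [|m] in f a fO defu *.
  move: qu; rewrite defu big_ord0 /qform mulmx0 mxE => /esym/eqP.
  by rewrite oppr_eq0 oner_eq0.
have e1 : j u * \prod_i j (f i) = s ((- 1) ^+ m) * (\prod_i j (f i) * j u).
  rewrite [in j u]defu !raddf_sum mulr_suml !mulr_sumr; apply: eq_bigr => k _.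
  rewrite jZ -mulrA cmap_orthogonal_prod //= mulrA sC -[LHS]mulrA; congr (_ * _).
  by rewrite [RHS]mulrA sC mulrA.
have := twists_prod f (fun v => cmap_reflection v qu).
rewrite e1 exprS mulN1r rmorphN mulNr => e2.
have sgn : s ((- 1) ^+ m) * s ((- 1) ^+ m) = 1.
  by rewrite -rmorphM -exprD addnn -mul2n exprM sqrrN !expr1n rmorph1.
have cancel_ju t : s ((- 1) ^+ m) * (s ((- 1) ^+ m) * (t * j u)) * - j u = t.
  by rewrite mulrA sgn mul1r -mulrA ju1 mulr1.
by rewrite -[LHS]cancel_ju -[X in _ * X * _]opprK -e2 [s _ * - _]mulrN mulNr cancel_ju.
Qed.

End CliffordMap.

(** * The Clifford algebra and the covering of the orthogonal group by Pin *)

Section Clifford.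
Variables (K : fieldType) (n : nat) (B : 'M[K]_n).
Local Notation Cl := (clifford B).

Definition cliff_scalar (c : K) : Cl := c *: (1 : Cl).

Fact cliff_scalar_is_zmod_morphism : zmod_morphism cliff_scalar.
Proof. by move=> a b; rewrite /cliff_scalar scalerBl. Qed.
HB.instance Definition _ :=
  GRing.isZmodMorphism.Build K Cl cliff_scalar cliff_scalar_is_zmod_morphism.

Fact cliff_scalar_is_monoid_morphism : monoid_morphism cliff_scalar.
Proof.
split=> [|a b]; first exact: scale1r.
by rewrite /cliff_scalar -quot_scaleAl mul1r scalerA.
Qed.
HB.instance Definition _ :=
  GRing.isMonoidMorphism.Build K Cl cliff_scalar cliff_scalar_is_monoid_morphism.

Fact cliff_inj_is_zmod_morphism : zmod_morphism (cliff_inj B).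
Proof. by move=> u v; rewrite /cliff_inj raddfB /= raddfB. Qed.
HB.instance Definition _ :=
  GRing.isZmodMorphism.Build 'cV[K]_n Cl (cliff_inj B) cliff_inj_is_zmod_morphism.

Lemma cliff_scalarC c (x : Cl) : x * cliff_scalar c = cliff_scalar c * x.
Proof. by rewrite /cliff_scalar -quot_scaleAr -quot_scaleAl mulr1 mul1r. Qed.

Lemma cliff_injZ c v : cliff_inj B (c *: v) = cliff_scalar c * cliff_inj B v.
Proof.
rewrite /cliff_scalar -quot_scaleAl mul1r.
by rewrite /cliff_inj linearZ /= linearZ.
Qed.

Lemma cliff_inj_sqrE v :
  cliff_inj B v * cliff_inj B v = cliff_scalar (qform B v).
Proof. exact: cliff_inj_sqr. Qed.

Hypothesis symB : B^T = B.

Lemma pin_cover_unit (x : Cl) M : pin_cover x M -> exists y, x * y = 1 /\ y * x = 1.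
Proof.
elim=> [|u qu|y z N P _ [y' yK] _ [z' zK]|y z N yz zy _ _].
- by exists 1; split; apply: mulr1.
- exists (- cliff_inj B u); exact: (cmap_unit cliff_inj_sqrE qu).
- by exists (z' * y'); exact: (inverseM yK zK).
- by exists y.
Qed.

Lemma pin_cover_det (x : Cl) M : pin_cover x M -> \det M != 0.
Proof.
elim=> [|u qu|y z N P _ uN _ uP|y z N yz zy _ uN]; first by rewrite det1 oner_eq0.
- by rewrite det_reflection ?qu ?oppr_eq0 ?oner_eq0.
- by rewrite det_mulmx mulf_neq0.
- by rewrite det_inv invr_eq0.
Qed.

(** Conjugation by a generator u is -r_u, and -1 = det r_u; both factors are multiplicative. *)
Lemma pin_cover_twists (x : Cl) M : pin_cover x M ->
  twists (@cliff_scalar) (cliff_inj B) x M (\det M).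
Proof.
elim=> [|u qu|y z N P _ yN _ zP|y z N yz zy yN' yN].
- rewrite det1; exact: twists1.
- have -> : \det (reflection B u) = - 1.
    by rewrite det_reflection ?qu ?oppr_eq0 ?oner_eq0.
  move=> v; exact: (cmap_reflection symB cliff_injZ cliff_inj_sqrE).
- rewrite det_mulmx; exact: (twistsM cliff_scalarC yN zP).
- rewrite det_inv; have nz := pin_cover_det yN'.
  have uN : N \in unitmx by rewrite unitmxE unitfE.
  exact: (twistsV cliff_scalarC yz zy uN nz yN).
Qed.

Lemma pin_cover_comm (x z : Cl) M : pin_cover x M ->
  (forall v, GRing.comm z (cliff_inj B v)) -> GRing.comm z x.
Proof.
move=> xM zj; elim: xM => [|u _|a b N P _ za _ zb|a b N ab ba _ za].
- exact: commr1.
- exact: zj.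
- exact: (commrM za zb).
- exact: (comm_inverse ab ba za).
Qed.

Lemma pin_cover_prod (I : Type) (r : seq I) (x : I -> Cl) M :
    (forall i, pin_cover (x i) (M i)) ->
  pin_cover (\prod_(i <- r) x i) (\big[mulmx/1%:M]_(i <- r) M i).
Proof.
move=> xM; elim: r => [|i r ih]; first by rewrite !big_nil; constructor.
by rewrite !big_cons; constructor.
Qed.

(* Two lifts of the same isometry differ by a central element, so the         *)
(* commutator of a lift of [M] with [x] depends on [M] only.                  *)
Lemma pin_cover_same_comm (x y y0 : Cl) A M c : pin_cover x A ->
    pin_cover y M -> pin_cover y0 M ->
  x * y0 = cliff_scalar c * (y0 * x) -> x * y = cliff_scalar c * (y * x).
Proof.
move=> xA yM y0M e.
have [y1 [y01 y10]] := pin_cover_unit y0M.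
have uM : M \in unitmx by rewrite unitmxE unitfE (pin_cover_det yM).
have zM : pin_cover (y * y1) (M *m invmx M).
  exact: (pin_coverM yM (pin_coverV y01 y10 y0M)).
rewrite (mulmxV uM) in zM.
apply: (comm_factor cliff_scalarC y10 _ e); apply: (pin_cover_comm xA) => v.
have := pin_cover_twists zM v; rewrite det1 rmorph1 mul1r mul1mx; exact.
Qed.

End Clifford.

(** * Kronecker products *)

Section TensorMatrices.
Variable R : comPzRingType.

Lemma tensmxDl m n p q (M N : 'M[R]_(m, n)) (P : 'M_(p, q)) :
  (M + N) *t P = M *t P + N *t P.
Proof. by apply/matrixP=> i k; rewrite !mxE mulrDl. Qed.

Lemma tensmxDr m n p q (M : 'M[R]_(m, n)) (N P : 'M_(p, q)) :
  M *t (N + P) = M *t N + M *t P.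
Proof. by apply/matrixP=> i k; rewrite !mxE mulrDr. Qed.

Lemma tensmxZl m n p q c (M : 'M[R]_(m, n)) (P : 'M_(p, q)) :
  (c *: M) *t P = c *: (M *t P).
Proof. by apply/matrixP=> i k; rewrite !mxE mulrA. Qed.

Lemma tensmxZr m n p q c (M : 'M[R]_(m, n)) (P : 'M_(p, q)) :
  M *t (c *: P) = c *: (M *t P).
Proof. by apply/matrixP=> i k; rewrite !mxE mulrCA. Qed.

Lemma tensmx11 m n : (1%:M : 'M[R]_m) *t (1%:M : 'M[R]_n) = 1%:M.
Proof.
apply/matrixP=> i k; case: (mxtens_indexP i) (mxtens_indexP k) => i1 i2 [k1 k2].
rewrite tensmxE !mxE -natrM mulnb.
by rewrite (can_eq (@mxtens_indexK _ _)) xpair_eqE.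
Qed.

(** [u *t w] has [1 * 1] columns; the ascription turns it into a column vector by conversion. *)
Definition tcol m n (u : 'cV[R]_m) (w : 'cV[R]_n) : 'cV[R]_(m * n) := u *t w.

Lemma mul_tcol m n (M : 'M[R]_m) (N : 'M[R]_n) u w :
  (M *t N) *m tcol u w = tcol (M *m u) (N *m w).
Proof. exact: (tensmx_mul M N u w). Qed.

Lemma tcol_sum m n (I : finType) (a : I -> R) (f : I -> 'cV[R]_m) (w : 'cV[R]_n) :
  tcol (\sum_i a i *: f i) w = \sum_i a i *: tcol (f i) w.
Proof.
apply/matrixP=> i k; rewrite mxE !summxE mulr_suml; apply: eq_bigr => l _.
by rewrite !mxE mulrA.
Qed.

Lemma tcol_outer m n (u : 'cV[R]_m) (w : 'cV[R]_n) (B : 'M[R]_m) (B' : 'M[R]_n) :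
  tcol u w *m ((tcol u w)^T *m (B *t B')) =
  (u *m (u^T *m B)) *t (w *m (w^T *m B')).
Proof.
by rewrite -tensmx_mul -[(u^T *m B) *t _]tensmx_mul -trmx_tens.
Qed.

(** All cross terms vanish. It is applied to the projections onto the lines of an orthonormal basis,
    whose sum is 1. *)
Lemma prod_add1_tensmx m n p (P : 'I_p -> 'M[R]_m) (Q : 'M[R]_n) :
    (forall i k, i != k -> P i *m P k = 0) ->
  \big[mulmx/1%:M]_i (1%:M + P i *t Q) = 1%:M + (\sum_i P i) *t Q.
Proof.
elim: p P => [|p ih] P PO; first by rewrite !big_ord0 tens0mx addr0.
rewrite !big_ord_recl ih => [|i k ik]; last by apply: PO; rewrite (inj_eq lift_inj).
have -> : (1%:M + P ord0 *t Q) *m (1%:M + (\sum_i P (lift ord0 i)) *t Q) =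
    1%:M + P ord0 *t Q + (\sum_i P (lift ord0 i)) *t Q.
  rewrite mulmxDr mulmx1 mulmxDl mul1mx tensmx_mul.
  suff -> : P ord0 *m \sum_i P (lift ord0 i) = 0 by rewrite tens0mx addr0.
  by rewrite mulmx_sumr big1 // => i _; apply: PO.
by rewrite tensmxDl addrA.
Qed.

End TensorMatrices.

Lemma col_basis_sum (K : fieldType) n (M : 'M[K]_n) (u : 'cV[K]_n) : M \in unitmx ->
  u = \sum_i (invmx M *m u) i 0 *: col i M.
Proof.
move=> uM; rewrite -{1}[u](mulKVmx uM); apply/colP=> k.
by rewrite mxE summxE; apply: eq_bigr => i _; rewrite !mxE mulrC.
Qed.

(** * Reflections and volume elements in the tensor product *)

Section TensorForm.
Variables (K : fieldType) (d d' : nat) (B : 'M[K]_d) (B' : 'M[K]_d').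
Hypotheses (symB : B^T = B) (symB' : B'^T = B').
Local Notation BB := (B *t B').
Local Notation s := (cliff_scalar BB).
Local Notation j := (cliff_inj BB).

Lemma tensmx_sym : BB^T = BB.
Proof. by rewrite trmx_tens symB symB'. Qed.

Lemma bform_tcol u w u1 w1 :
  bform BB (tcol u w) (tcol u1 w1) = bform B u u1 * bform B' w w1.
Proof.
have -> : bform BB (tcol u w) (tcol u1 w1) =
    ((u^T *m B *m u1) *t (w^T *m B' *m w1)) 0 0.
  by rewrite -!tensmx_mul -trmx_tens.
by rewrite mxE !ord1.
Qed.

Lemma qform_tcol u w : qform BB (tcol u w) = qform B u * qform B' w.
Proof. exact: bform_tcol. Qed.

(** On the slice V (x) w, a reflection of V is induced by one of the whole tensor product along a
    vector of norm -1, to which [cmap_reflection_prod] applies. *)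
Lemma reflection_tcol u w v : qform B u = 1 -> qform B' w = - 1 ->
  reflection BB (tcol u w) *m tcol v w = tcol (reflection B u *m v) w.
Proof.
move=> qu qw; rewrite !reflectionE qform_tcol bform_tcol qu -[bform B' w w]/(qform B' w) qw.
apply/matrixP=> i k; rewrite !mxE mul1r divr1 invrN1; ring.
Qed.

(** By Sylvester's identity the determinant is that of the scalar matrix -1 of size d'. *)
Lemma det_reflection_tens u : qform B u != 0 ->
  \det (reflection B u *t (1%:M : 'M[K]_d')) = (- 1) ^+ d'.
Proof.
move=> qu; have -> : reflection B u *t 1%:M = 1%:M +
    (- (2%:R / qform B u) *: u *t (1%:M : 'M[K]_d')) *m ((u^T *m B) *t 1%:M).
  by rewrite tensmx_mul mulmx1 -scalemxAl scaleNr -tensmx11 /reflection tensmxDl.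
rewrite det_add1_mulmx tensmx_mul mulmx1 -scalemxAr bformE.
rewrite -[bform B u u]/(qform B u) scale_scalar_mx mulNr divfK //.
have -> : (- 2%:R)%:M *t (1%:M : 'M[K]_d') = (- 2%:R)%:M :> 'M_(1 * d').
  by rewrite -[X in X *t _]scalemx1 tensmxZl tensmx11 scalemx1.
rewrite -raddfD /= mulr2n opprD addNKr.
by rewrite det_scalar mul1n.
Qed.

Lemma det_reflection_prod_tens us : {in us, forall u, qform B u != 0} ->
  \det (reflection_prod B us *t (1%:M : 'M[K]_d')) = \det (reflection_prod B us) ^+ d'.
Proof.
move=> usq; rewrite det_reflection_prod // exprAC.
elim: us usq => [_|u us ih usq]; first by rewrite /reflection_prod big_nil tensmx11 det1.
rewrite reflection_prod_cons -[1%:M]mul1mx -tensmx_mul det_mulmx.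
rewrite det_reflection_tens ?usq ?mem_head // ih ?exprS // => v vus.
by apply: usq; rewrite inE vus orbT.
Qed.

(** The volume element of V (x) w scales by the determinant: each reflection of V contributes one
    sign. *)
Lemma cliff_prod_reflection_prod (E : 'M[K]_d) us w :
    orthonormal_basis B E -> {in us, forall u, qform B u = 1} -> qform B' w = - 1 ->
  \prod_i j (tcol (reflection_prod B us *m col i E) w) =
  s ((- 1) ^+ size us) * \prod_i j (tcol (col i E) w).
Proof.
move=> EO; elim: us => [_ qw|u us ih usq qw].
  rewrite rmorph1 mul1r; apply: eq_bigr => i _.
  by rewrite /reflection_prod big_nil mul1mx.
have usq' : {in us, forall v, qform B v = 1}.
  by move=> v vus; apply: usq; rewrite inE vus orbT.
have qu : qform B u = 1 by apply: usq; rewrite mem_head.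
rewrite /= exprS mulN1r rmorphN mulNr -ih // reflection_prod_cons.
set P := reflection_prod B us.
have PO : P^T *m B *m P = B.
  by apply: reflection_prod_gram => // v /usq' ->; rewrite oner_eq0.
(* The vectors P e_i still form a basis, so [u] expands in them as [cmap_reflection_prod]
   requires. *)
have uPE : P *m E \in unitmx.
  have : (P *m E)^T *m B *m (P *m E) = 1%:M.
    by rewrite -EO -{2}PO trmx_mul !mulmxA.
  by move=> /mulmx1_unit[].
pose f i := tcol (P *m col i E) w.
rewrite -(@cmap_reflection_prod _ _ BB _ s j tensmx_sym (@cliff_scalarC _ _ BB)
   (@cliff_injZ _ _ BB) (@cliff_inj_sqrE _ _ BB) _ f
   (fun i => (invmx (P *m E) *m u) i 0) (tcol u w)).
- by apply: eq_bigr => i _; rewrite /f reflection_tcol // mulmxA.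
- by move=> i l il; rewrite /f bform_tcol bform_gram // bform_col EO mxE (negbTE il) mul0r.
- rewrite -tcol_sum {1}(col_basis_sum u uPE); congr tcol; apply: eq_bigr => i _.
  by rewrite !colE mulmxA.
- by rewrite qform_tcol qu qw mul1r.
Qed.

(** The reflection along e_i (x) w is 1 + P_i (x) N, with P_i the projection onto e_i and N
    independent of i; their product over i is 1 (x) (1 + N) = 1 (x) r_w. *)
Lemma pin_cover_tens_reflection (E : 'M[K]_d) w :
    orthonormal_basis B E -> qform B' w = - 1 ->
  pin_cover (\prod_i j (tcol (col i E) w)) (1%:M *t reflection B' w).
Proof.
move=> EO qw; have bE i k : bform B (col i E) (col k E) = (i == k)%:R.
  by rewrite bform_col EO mxE.
have -> : 1%:M *t reflection B' w = \big[mulmx/1%:M]_i reflection BB (tcol (col i E) w).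
  pose P i := col i E *m ((col i E)^T *m B).
  rewrite (eq_bigr (fun i => 1%:M + P i *t (2%:R *: (w *m (w^T *m B'))))) => [|i _].
    rewrite prod_add1_tensmx => [|i k ik].
      (* Completeness of the basis: E E^T B = 1 follows from E^T B E = 1. *)
      have -> : \sum_i P i = 1%:M.
        rewrite -[RHS](mulmx1C EO); apply/matrixP=> i k.
        rewrite summxE mxE; apply: eq_bigr => l _.
        by rewrite /P tr_col -row_mul mxE big_ord1 !mxE.
      by rewrite -tensmx11 -tensmxDr /reflection qw invrN1 mulrN1 scaleNr opprK.
    rewrite /P -mulmxA [_ *m (col k E *m _)]mulmxA bformE bE (negbTE ik).
    by rewrite raddf0 mul0mx mulmx0.
  rewrite /reflection tcol_outer qform_tcol qw -[qform B _]/(bform B _ _) bE eqxx.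
  by rewrite mul1r invrN1 mulrN1 scaleNr opprK tensmxZr.
apply: pin_cover_prod => i; apply: pin_cover_gen.
by rewrite qform_tcol qw -[qform B _]/(bform B _ _) bE eqxx mul1r.
Qed.

End TensorForm.

(** * The commutator of lifts of A (x) 1 and 1 (x) C *)

Section TensorCommutator.
Variables (K : numClosedFieldType) (d d' : nat) (B : 'M[K]_d) (B' : 'M[K]_d').
Hypotheses (symB : B^T = B) (symB' : B'^T = B').
Hypotheses (uB : B \in unitmx) (uB' : B' \in unitmx).
Local Notation BB := (B *t B').
Local Notation s := (cliff_scalar BB).
Local Notation j := (cliff_inj BB).

Lemma tens_commute_reflection x (E A : 'M[K]_d) w :
    orthonormal_basis B E -> A^T *m B *m A = B ->
    pin_cover x (A *t 1%:M) -> qform B' w = - 1 ->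
  x * \prod_i j (tcol (col i E) w) =
  s (\det A ^+ (d * d' + 1)) * (\prod_i j (tcol (col i E) w) * x).
Proof.
move=> EO AO xA qw.
(* Norm 1 on this side and norm -1 for [w] make each u (x) w a generator of Pin. *)
have [us usq defA] := orthogonal_reflection_prod symB (oner_neq0 _) EO AO.
have usn : {in us, forall u, qform B u != 0} by move=> u /usq ->; apply: oner_neq0.
have detA1 : \det (A *t (1%:M : 'M_d')) = \det A ^+ d'.
  by rewrite defA; apply: det_reflection_prod_tens.
have detA : \det A = (- 1) ^+ size us by rewrite defA; apply: det_reflection_prod.
have tw := twists_prod (@cliff_scalarC _ _ BB) (fun i => tcol (col i E) w)
  (pin_cover_twists (tensmx_sym symB symB') xA).
have vol := cliff_prod_reflection_prod symB symB' EO usq qw.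
rewrite -defA -detA in vol.
(* Passing the [d] factors contributes exponent d d'; the change of volume element contributes 1. *)
have detM : \det A ^+ (d * d' + 1) = \det (A *t (1%:M : 'M_d')) ^+ d * \det A.
  by rewrite detA1 -exprM mulnC exprD expr1.
rewrite detM; apply: (comm_factorZ tw); rewrite -vol; apply: eq_bigr => i _.
by rewrite mul_tcol mul1mx.
Qed.

Lemma tens_commute x y (A : 'M[K]_d) (C : 'M[K]_d') :
    A^T *m B *m A = B -> C^T *m B' *m C = B' ->
    pin_cover x (A *t 1%:M) -> pin_cover y (1%:M *t C) ->
  exists2 m, \det C = (- 1) ^+ m &
    x * y = s ((\det A ^+ (d * d' + 1)) ^+ m) * (y * x).
Proof.
move=> AO CO xA yC; have [E EO] := exists_orthonormal_basis symB uB.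
have [E' EO'] := exists_orthonormal_basis symB' uB'.
have nz1 : (- 1 : K) != 0 by rewrite oppr_eq0 oner_eq0.
have [ws wsq defC] := orthogonal_reflection_prod symB' nz1 EO' CO.
exists (size ws).
  by rewrite defC; apply: det_reflection_prod => u /wsq ->.
(* One lift of 1 (x) C suffices, and it is built reflection by reflection. *)
suff [y0 y0C xy0] : exists2 y0, pin_cover y0 (1%:M *t C) &
    x * y0 = s ((\det A ^+ (d * d' + 1)) ^+ size ws) * (y0 * x).
  exact: (pin_cover_same_comm (tensmx_sym symB symB') xA yC y0C xy0).
rewrite {}defC {yC CO}; elim: ws wsq => [_|w ws ih wsq].
  exists 1; first by rewrite /reflection_prod big_nil tensmx11; apply: pin_cover1.
  by rewrite expr0 rmorph1 !mul1r mulr1.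
have [v vws|y0 y0C xy0] := ih; first by apply: wsq; rewrite inE vws orbT.
have qw : qform B' w = - 1 by apply: wsq; rewrite mem_head.
exists (\prod_i j (tcol (col i E) w) * y0).
  rewrite reflection_prod_cons -[1%:M]mul1mx -tensmx_mul.
  exact: (pin_coverM (pin_cover_tens_reflection EO qw) y0C).
have xw := tens_commute_reflection EO AO xA qw.
rewrite exprS; exact: (comm_factorM (@cliff_scalarC _ _ BB) xw xy0).
Qed.

End TensorCommutator.

(** * Nontriviality of the Clifford algebra *)

Section CliffordNontrivial.
Variables (K : fieldType) (n : nat) (A : algType K).

Definition word_prod (f : 'I_n -> A) (k : {fmonom 'I_n}) : A := \prod_(i <- k) f i.

Fact word_prod_is_mmorphism (f : 'I_n -> A) : mmorphism (word_prod f).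
Proof.
by split=> [k l|]; rewrite /word_prod ?fmM ?big_cat // fm1 big_nil.
Qed.
HB.instance Definition _ (f : 'I_n -> A) :=
  isMultiplicative.Build {fmonom 'I_n} A (word_prod f) (word_prod_is_mmorphism f).

(** Universal property: [g] extends to the tensor algebra, kills the ideal and sends 1 to 1, which
    is nonzero in [A]. *)
Lemma clifford_neq0 (B : 'M[K]_n) (g : {linear 'cV[K]_n -> A}) :
  (forall v, g v * g v = (qform B v)%:A) -> (1 : clifford B) != 0.
Proof.
move=> g_sqr; pose h := word_prod (fun i => g (delta_mx i 0)).
pose ev : tensor_alg K n -> A := mmap (in_alg A) h.
have evD x y : ev (x + y) = ev x + ev y by apply: mmapD.
have hC (p : tensor_alg K n) k l : GRing.comm (in_alg A p@_k) (h l).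
  by rewrite /GRing.comm /= mulr_algl mulr_algr.
have [evM ev1] : {morph ev : x y / x * y} * (ev 1 = 1).
  exact: (commr_mmap_is_multiplicative hC).
have ev00 : ev 0 = 0 by apply: mmap0.
have evB x y : ev (x - y) = ev x - ev y by apply: mmapB.
have evZ c x : ev (c *: x) = c *: ev x.
  by rewrite /ev mmapZ /= mulr_algl.
have evg v : ev (tensor_inj v) = g v.
  rewrite /tensor_inj (big_morph ev evD ev00) {2}[v]matrix_sum_delta.
  rewrite linear_sum /=; apply: eq_bigr => i _.
  rewrite big_ord1 linearZ evZ /ev mmapU /= scale1r mul1r.
  by rewrite /h /word_prod fmU big_seq1.
have ev0 x : gen_ideal (fun x : tensor_alg K n =>
    exists v, x = tensor_inj v * tensor_inj v - (qform B v)%:A) x -> ev x = 0.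
  elim=> [|y z _ y0 _ z0|a t b [v ->]]; first exact: ev00.
    by rewrite evD y0 z0 addr0.
  by rewrite !evM evB evM evZ ev1 evg g_sqr subrr mulr0 mul0r.
apply/eqP=> e.
have /quot_pi_eq/ev0/eqP :
    quot_pi _ (1 : tensor_alg K n) = quot_pi _ 0 :> clifford B.
  by rewrite raddf0 -e.
by rewrite subr0 ev1 oner_eq0.
Qed.

End CliffordNontrivial.

(* Doubling the size of the matrices makes room for one more generator:       *)
(* the square of [[g, a], [a, -g]] is [g ^ 2 + a ^ 2].                        *)
Lemma clifford_matrices (K : fieldType) n : exists m (g : 'cV[K]_n -> 'M[K]_m),
  [/\ (0 < m)%N, linear g & forall v, g v *m g v = ((v^T *m v) 0 0)%:M].
Proof.
elim: n => [|n [m [g [m0 gL g_sqr]]]].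
  exists 1%N, (fun=> 0); split=> // [c u v|v]; first by rewrite scaler0 addr0.
  by rewrite mulmx0 mxE big_ord0 raddf0.
pose t (v : 'cV[K]_(1 + n)) := dsubmx v; pose a (v : 'cV[K]_(1 + n)) := v 0 0.
exists (m + m)%N, (fun v => block_mx (g (t v)) (a v)%:M (a v)%:M (- g (t v))).
split=> [|c u v|v]; first by rewrite addn_gt0 m0.
  have -> : t (c *: u + v) = c *: t u + t v by rewrite /t linearP.
  have -> : a (c *: u + v) = c * a u + a v by rewrite /a !mxE.
  by rewrite gL scale_block_mx add_block_mx !raddfD /= -!scale_scalar_mx scalerN.
rewrite mulmx_block !mulmxN !mulNmx opprK !g_sqr !mul_scalar_mx !mul_mx_scalar subrr.
rewrite scale_scalar_mx -!raddfD /= [_ + a v * a v]addrC -scalar_mx_block.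
congr _%:M; rewrite [RHS]mxE big_ord_recl mxE; congr (_ + _); first by rewrite mxE.
apply: eq_bigr => i _; rewrite !mxE.
by have -> : rshift 1 i = lift ord0 i by apply: val_inj.
Qed.

(** [F] pulls the standard form back to [B], so composing with it transports the Clifford
    matrices. *)
Lemma clifford_gram_neq0 (K : fieldType) n (B F : 'M[K]_n) :
  F^T *m F = B -> (1 : clifford B) != 0.
Proof.
move=> defB; have [[|m] [g [//= _ gL g_sqr]]] := clifford_matrices K n.
pose gF v := g (F *m v).
have gFL : linear gF by move=> c u v; rewrite /gF linearP gL.
pose gM := GRing.isLinear.Build K 'cV[K]_n 'M[K]_m.+1 *:%R gF gFL.
pose gH : {linear 'cV[K]_n -> 'M[K]_m.+1} := HB.pack gF gM.
apply: (@clifford_neq0 _ _ _ _ gH) => v.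
have := g_sqr (F *m v); rewrite trmx_mul -!mulmxA [F^T *m _]mulmxA defB mulmxA.
by rewrite -scalemx1.
Qed.

Lemma clifford_tens_neq0 (K : numClosedFieldType) d d' (B : 'M[K]_d) (B' : 'M[K]_d') :
  nondeg_gram B -> nondeg_gram B' -> (1 : clifford (B *t B')) != 0.
Proof.
have square_root n (C : 'M[K]_n) : nondeg_gram C -> exists F : 'M_n, F^T *m F = C.
  move=> [symC uC]; have [E EO] := exists_orthonormal_basis symC uC.
  have [_ uE] := mulmx1_unit EO; exists (invmx E).
  have -> : (invmx E)^T = C *m E.
    rewrite trmx_inv -[RHS](mulKmx (_ : E^T \in unitmx)) ?unitmx_tr //.
    by rewrite [E^T *m _]mulmxA EO mulmx1.
  by rewrite mulmxK.
move=> /square_root[F defB] /square_root[F' defB'].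
by apply: (@clifford_gram_neq0 _ _ _ (F *t F')); rewrite trmx_tens tensmx_mul defB defB'.
Qed.

(** * The spinoriality criterion *)

Lemma det_gram (K : fieldType) n (B M : 'M[K]_n) : B \in unitmx ->
  M^T *m B *m M = B -> exists b : bool, \det M = (- 1) ^+ b.
Proof.
move=> uB /(congr1 determinant); rewrite !det_mulmx det_tr mulrAC -expr2.
rewrite -[RHS]mul1r => /mulIf; rewrite -unitfE -unitmxE => /(_ uB)/eqP.
by rewrite sqrf_eq1 => /orP[]/eqP->; [exists false | exists true].
Qed.

Lemma pair_mulg1 (gT gT' : finGroupType) (g : gT) (g' : gT') :
  ((g, 1) * (1, g') = (g, g'))%g.
Proof. by congr pair; rewrite ?mulg1 ?mul1g. Qed.

Lemma pair_mul1g (gT gT' : finGroupType) (g : gT) (g' : gT') :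
  ((1, g') * (g, 1) = (g, g'))%g.
Proof. by congr pair; rewrite ?mulg1 ?mul1g. Qed.

Theorem theorem1p6 (R : realType) (gT gT' : finGroupType)
    (G : {group gT}) (G' : {group gT'}) (d d' : nat)
    (B : 'M[R[i]]_d) (B' : 'M[R[i]]_d')
    (rG : mx_representation R[i] G d) (rG' : mx_representation R[i] G' d')
    (HB : nondeg_gram B) (HB' : nondeg_gram B')
    (rGO : orthogonal_repr B rG) (rG'O : orthogonal_repr B' rG') :
  let Pi := ext_tensor_repr rG rG' in
  spinorial (B *t B') Pi <->
  (spinorial (B *t B') (subg_repr Pi (setX1_sub G G'))
     /\ spinorial (B *t B') (subg_repr Pi (set1X_sub G G')))
  /\ [\/ ~~ odd (d * d' + 1), trivial_det rG | trivial_det rG'].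
Proof.
move=> Pi; have [symB uB] := HB; have [symB' uB'] := HB'.
have nz2 : (2%:R : R[i]) != 0 by rewrite pnatr_eq0.
have gramG g : g \in G -> (rG g)^T *m B *m rG g = B.
  by move=> Gg; apply: orthogonal_gram => //; apply: rGO.
have gramG' g : g \in G' -> (rG' g)^T *m B' *m rG' g = B'.
  by move=> Gg; apply: orthogonal_gram => //; apply: rG'O.
have commute g g' x y : g \in G -> g' \in G' ->
    pin_cover x (Pi (g, 1%g)) -> pin_cover y (Pi (1%g, g')) ->
  exists2 m, \det (rG' g') = (- 1) ^+ m & x * y =
    cliff_scalar (B *t B') ((\det (rG g) ^+ (d * d' + 1)) ^+ m) * (y * x).
  move=> Gg G'g'; rewrite /= /ext_tensor_mx /= !repr_mx1 => xg yg'.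
  exact: (tens_commute symB symB' uB uB' (gramG g Gg) (gramG' g' G'g') xg yg').
have sub1 g : g \in G -> (g, 1%g) \in setX G G' by move=> Gg; apply/setXP; rewrite group1.
have sub2 g' : g' \in G' -> (1%g, g') \in setX G G' by move=> Gg; apply/setXP; rewrite group1.
split=> [[phi [phi_pin phiM phi_cover]]|[[
  [phi [phi_pin phiM phi_cover]] [psi [psi_pin psiM psi_cover]]] hdet]].
  split.
    have restrict (H : {group gT * gT'}) (sHG : H \subset setX G G') :
        spinorial (B *t B') (subg_repr Pi sHG).
      exists phi; split=> [g Hg|g h Hg Hh|g Hg].
      - exact: phi_pin (subsetP sHG _ Hg).
      - exact: phiM (subsetP sHG _ Hg) (subsetP sHG _ Hh).
      - exact: phi_cover (subsetP sHG _ Hg).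
    by split; apply: restrict.
  (* If (ii) fails, some g and g' both have determinant -1. The lifts of (g, 1) and (1, g') then
     anticommute, while both products equal [phi (g, g')], an invertible element. *)
  have [odd_dd|] := boolP (odd (d * d' + 1)); last by move=> even_dd; apply: Or31.
  have [/forall_inP det1|] := boolP [forall g in G, \det (rG g) == 1].
    by apply: Or32 => g Gg; apply/eqP/det1.
  rewrite negb_forall_in => /exists_inP[g Gg detg].
  have [/forall_inP det1|] := boolP [forall g in G', \det (rG' g) == 1].
    by apply: Or33 => g' G'g'; apply/eqP/det1.
  rewrite negb_forall_in => /exists_inP[g' G'g' detg'].
  have gg' : (g, g') \in setX G G' by apply/setXP.
  have [m detm xy] := commute _ _ _ _ Gg G'g' (phi_cover _ (sub1 g Gg))
    (phi_cover _ (sub2 g' G'g')).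
  have odd_m : odd m by move: detg'; rewrite detm -signr_odd; case: odd; rewrite ?eqxx.
  have [[] detb] := det_gram uB (gramG g Gg); last by rewrite detb eqxx in detg.
  have sgn : (\det (rG g) ^+ (d * d' + 1)) ^+ m = - 1.
    by rewrite detb expr1 -exprM -signr_odd oddM odd_dd odd_m.
  have e1 := phiM _ _ (sub1 g Gg) (sub2 g' G'g').
  have e2 := phiM _ _ (sub2 g' G'g') (sub1 g Gg).
  rewrite pair_mulg1 in e1; rewrite pair_mul1g in e2.
  have [z [zz' _]] := pin_cover_unit (phi_cover _ gg').
  rewrite sgn -e1 -e2 in xy.
  have := clifford_tens_neq0 HB HB'; rewrite (opp_unit_eq0 nz2 zz' xy).
  by rewrite eqxx.
(* Each case of (ii) kills the sign: an even exponent, base 1, or, when det C = 1, an even [m]. *)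
have sgn g g' m : g \in G -> g' \in G' -> \det (rG' g') = (- 1) ^+ m ->
    (\det (rG g) ^+ (d * d' + 1)) ^+ m = 1.
  move=> Gg G'g' detm; have [b detb] := det_gram uB (gramG g Gg).
  case: hdet => [even_dd|det1|det1].
  - by rewrite detb -!exprM -signr_odd !oddM (negbTE even_dd) andbF.
  - by rewrite det1 // !expr1n.
  rewrite (det1 _ G'g') -signr_odd in detm.
  have even_m : odd m = false.
    case: (odd m) detm => // /eqP; rewrite expr1 -addr_eq0 -mulr2n.
    by rewrite (negbTE nz2).
  by rewrite detb -!exprM -signr_odd !oddM even_m !andbF.
have phi_psi g g' : g \in G -> g' \in G' -> GRing.comm (phi (g, 1%g)) (psi (1%g, g')).
  move=> Gg G'g'.
  have Hg : (g, 1%g) \in setX G (1%g : {set gT'}) by apply/setXP; rewrite group1.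
  have Hg' : (1%g, g') \in setX (1%g : {set gT}) G' by apply/setXP; rewrite group1.
  have [m detm xy] := commute _ _ _ _ Gg G'g' (phi_cover _ Hg) (psi_cover _ Hg').
  by rewrite (sgn _ _ _ Gg G'g' detm) rmorph1 mul1r in xy.
(* The product of the two lifts is multiplicative because, by [phi_psi], their values commute. *)
exists (fun p => phi (p.1, 1%g) * psi (1%g, p.2)).
have split1 p : p \in setX G G' -> (p.1, 1%g) \in setX G (1%g : {set gT'}).
  by case: p => p1 p2 /setXP[Gp _]; apply/setXP; rewrite group1.
have split2 p : p \in setX G G' -> (1%g, p.2) \in setX (1%g : {set gT}) G'.
  by case: p => p1 p2 /setXP[_ Gp]; apply/setXP; rewrite group1.
have fst_in p : p \in setX G G' -> p.1 \in G by case: p => p1 p2 /setXP[].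
have snd_in p : p \in setX G G' -> p.2 \in G' by case: p => p1 p2 /setXP[].
split=> [p Gp|p q Gp Gq|p Gp].
- exact: (pin_minusM (phi_pin _ (split1 p Gp)) (psi_pin _ (split2 p Gp))).
- have e1 := phiM _ _ (split1 p Gp) (split1 q Gq).
  have e2 := psiM _ _ (split2 p Gp) (split2 q Gq).
  have m1 : ((p.1, 1) * (q.1, 1) = ((p * q).1, 1) :> gT * gT')%g.
    by congr pair; rewrite mulg1.
  have m2 : ((1, p.2) * (1, q.2) = (1, (p * q).2) :> gT * gT')%g.
    by congr pair; rewrite mulg1.
  rewrite m1 in e1; rewrite m2 in e2.
  rewrite e1 e2; apply: comm_mulACA.
  exact: (phi_psi _ _ (fst_in q Gq) (snd_in p Gp)).
have PiE : Pi p = Pi (p.1, 1%g) *m Pi (1%g, p.2).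
  rewrite -(repr_mxM Pi (sub1 _ (fst_in p Gp)) (sub2 _ (snd_in p Gp))).
  by rewrite pair_mulg1 -surjective_pairing.
rewrite PiE; exact: (pin_coverM (phi_cover _ (split1 p Gp)) (psi_cover _ (split2 p Gp))).
Qed.
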